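(* Let $X$ be either $\ell_p=\ell_p(\mathbb{Z}_+)$ with $1\leq p<\infty$ or $X=c_0=c_0(\mathbb{Z}_+)$, and let $T:X\to X$ be a backward weighted shift with weight sequence $\{w_n\}_{n\in\mathbb{N}}$. Assume that $$\liminf_{n\to\infty}\Bigl(n!\prod_{j=1}^n|w_j|\Bigr)^{1/n}>0.$$ Then $I+T$ satisfies the Kitai Criterion.
   Context: Scalars are in $\mathbb{K}=\mathbb{R}$ or $\mathbb{C}$. A backward weighted shift on $\ell_p$ ($1\le p<\infty$) or $c_0$ with weight sequence $w=\{w_n\}_{n\in\mathbb{N}}$, a bounded sequence of non-zero numbers in $\mathbb{K}$, is the operator acting on the canonical basis $\{e_n\}_{n=0}^\infty$ by $Te_0=0$ and $Te_n=w_ne_{n-1}$ for $n\geq 1$. A bounded linear operator $T$ on a Banach space $X$ satisfies the Kitai Criterion if there exist dense subsets $E,F$ of $X$ and a map $S:F\to F$ such that $TSy=y$, $S^ky\to 0$ and $T^kx\to 0$ as $k\to\infty$ for all $y\in F$, $x\in E$. *)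

(* Defs.v *)
From mathcomp Require Import all_boot all_algebra.
From mathcomp Require Import all_classical all_reals all_analysis.
From mathcomp Require Import complex.
Import GRing.Theory Num.Theory numFieldNormedType.Exports.
Local Open Scope classical_set_scope.
Local Open Scope ring_scope.

Set Implicit Arguments.
Unset Strict Implicit.
Unset Printing Implicit Defensive.

Inductive seqspace (R : realType) := Lp of R | C0.

Section SeqSpaces.
Variables (R : realType) (K : numFieldType) (abs : K -> R).
(* abs is the modulus of the scalar field K (R or C), with values in R. *)

Definition space_ok (sp : seqspace R) : Prop :=
  match sp with Lp p => 1 <= p | C0 => True end.

Definition inX (sp : seqspace R) (x : nat -> K) : Prop :=
  match sp with
  | Lp p => cvgn (series (fun n => abs (x n) `^ p))
  | C0 => (fun n => abs (x n)) @ \oo --> (0 : R)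
  end.

Definition nrm (sp : seqspace R) (x : nat -> K) : R :=
  match sp with
  | Lp p => (limn (series (fun n => abs (x n) `^ p))) `^ (p^-1)
  | C0 => sup (range (fun n => abs (x n)))
  end.

Definition seqsub (x y : nat -> K) : nat -> K := fun n => x n - y n.

Definition dense_in (sp : seqspace R) (E : set (nat -> K)) : Prop :=
  (forall x, E x -> inX sp x) /\
  (forall x, inX sp x -> forall eps : R, 0 < eps ->
     exists e, E e /\ nrm sp (seqsub x e) < eps).

Definition tends0 (sp : seqspace R) (u : nat -> nat -> K) : Prop :=
  (fun k => nrm sp (u k)) @ \oo --> (0 : R).

(* backward weighted shift: T e_0 = 0, T e_n = w_n e_(n-1), i.e. (T x)_m = w_(m+1) x_(m+1) *)
Definition bwshift (w : nat -> K) (x : nat -> K) : nat -> K :=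
  fun m => w m.+1 * x m.+1.

Definition IplusT (w : nat -> K) (x : nat -> K) : nat -> K :=
  fun m => x m + bwshift w x m.

Definition weight_seq (w : nat -> K) : Prop :=
  (forall n, (1 <= n)%N -> w n != 0) /\ (exists M : R, forall n, abs (w n) <= M).

Definition Kitai (sp : seqspace R) (A : (nat -> K) -> (nat -> K)) : Prop :=
  exists (E F : set (nat -> K)) (S : (nat -> K) -> (nat -> K)),
    dense_in sp E /\ dense_in sp F /\
    (forall y, F y -> F (S y)) /\
    (forall y, F y -> A (S y) = y) /\
    (forall y, F y -> tends0 sp (fun k => iter k S y)) /\
    (forall x, E x -> tends0 sp (fun k => iter k A x)).

Definition growth_hyp (w : nat -> K) : Prop :=
  (0 < limn_einf (fun n : nat =>
     (((n`!)%:R * \prod_(1 <= j < n.+1) abs (w j)) `^ (n%:R^-1))%:E))%E.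

Definition theorem_for : Prop :=
  forall (sp : seqspace R) (w : nat -> K),
    space_ok sp -> weight_seq w -> growth_hyp w -> Kitai sp (IplusT w).

End SeqSpaces.

(* Main.v *)
(* Put a_n = w_1 ... w_n and x_n = f_n / a_n, so that T becomes the unweighted
   backward shift B of f.  For f_n = t^(n+1) / (n+1)! one has formally
   (I + B)^(-a) f = (t^(n+1) y_(a,n+1)(t))_n  with
   y_(a,m)(t) = sum_j C(-a,j) t^j / (m+j)!,  a Kummer function 1F1(a; m+1; -t) / m!.
   With Y = y_(a+1,m+1), the energy y^2 + a t Y^2 (y = y_(a,m)) has derivative
   a Y^2 (1 - 2(m+1) - 2t), hence is at most 1 / m!^2 when a t >= 0 and |t| <= 1/2.
   This makes n! |f_n| decay like |t|^n / sqrt k both for t < 0, a = -k (forward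
   orbits of I + T) and for t > 0, a = k (backward orbits), and the hypothesis on w
   turns it into norm decay.  Letting t tend to 0, the vectors f span, for either
   sign of t, a space whose closure contains every basis vector.  Backward orbits
   with this decay are unique, because (I + T) x = 0 forces |a_n x_n| = |x_0|, so S
   is the map taking a point to the next point of its backward orbit. *)
Require Import Defs.
From mathcomp Require Import all_boot all_order all_algebra.
From mathcomp Require Import all_classical all_reals all_analysis.
From mathcomp Require Import complex.
From mathcomp Require Import ring lra.
Import Order.TTheory GRing.Theory Num.Theory numFieldNormedType.Exports.
Local Open Scope classical_set_scope.
Local Open Scope ring_scope.

Set Implicit Arguments.
Unset Strict Implicit.
Unset Printing Implicit Defensive.

(** * The functions y_(a,m) and their energy estimate *)

Section Kummer.
Variable R : realType.
Implicit Types (a c s : R) (m j : nat).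

(* The binomial coefficient of [- a] over [j]. *)
Fixpoint nbin a j : R :=
  if j is i.+1 then nbin a i * (- (a + i%:R) / i.+1%:R) else 1.

Definition kcoef a m j : R := nbin a j / (m + j)`!%:R.

Definition kummer a m s : R := limn (pseries (kcoef a m) s).

Lemma factR_neq0 m : m`!%:R != 0 :> R.
Proof. by rewrite pnatr_eq0 -lt0n fact_gt0. Qed.

(** Absorption for binomial coefficients with upper index [- a]; it turns termwise differentiation
    into a shift of both [a] and [m] by one. *)
Lemma nbin_absorb a j : j.+1%:R * nbin a j.+1 = - a * nbin (a + 1) j.
Proof.
elim: j => [|j IH].
  by rewrite /= addr0 !mul1r divr1 mulr1.
rewrite [nbin a j.+2]/= -/(nbin a j.+1).
have -> : j.+2%:R * (nbin a j.+1 * (- (a + j.+1%:R) / j.+2%:R)) =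
          (j.+1%:R * nbin a j.+1) * (- (a + j.+1%:R) / j.+1%:R).
  have h1 : (j%:R + 1 : R) != 0 by rewrite natr1 pnatr_eq0.
  have h2 : (j%:R + 2 : R) != 0 by rewrite -natrD pnatr_eq0 addn2.
  have -> : j.+2%:R = j%:R + 2 :> R by rewrite -natrD addn2.
  by rewrite -(natr1 j); field; apply/andP.
rewrite IH /= -(natr1 j) -!mulrA; congr (_ * (_ * (_ * _))); ring.
Qed.

(** Pascal's rule with upper index [- a], the coefficient form of [kummer_shift]. *)
Lemma nbin_pascal a j : nbin a j.+1 = nbin (a + 1) j.+1 + nbin (a + 1) j.
Proof.
have h : (j.+1%:R : R) != 0 by rewrite pnatr_eq0.
apply: (mulfI h); rewrite nbin_absorb /= -(natr1 j); field.
by rewrite natr1.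
Qed.

Lemma nbin_le a j : `|nbin a j| <= (`|a| + 1) ^+ j.
Proof.
elim: j => [|j IH] /=; first by rewrite normr1 expr0.
rewrite normrM exprSr ler_pM// normrM normrN normfV (ger0_norm (ler0n _ _)).
rewrite ler_pdivrMr ?ltr0n//; apply: (le_trans (ler_normD _ _)).
rewrite (ger0_norm (ler0n _ _)) -(natr1 j).
have := normr_ge0 a; have := ler0n R j; nra.
Qed.

(** By [nbin_le] the exponential series at [(|a| + 1) * |s|] dominates, so convergence holds for
    every [s]. *)
Lemma kcoef_cvg a m s : cvgn (pseries (kcoef a m) s).
Proof.
apply: normed_cvg; rewrite /normed_series_of /=.
apply: (@series_le_cvg _ _ (exp_coeff ((`|a| + 1) * `|s|))) => [n|n|n|].
- exact: normr_ge0.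
- by rewrite /exp_coeff /= divr_ge0 // exprn_ge0 // mulr_ge0 ?addr_ge0.
- rewrite /exp_coeff /kcoef /= !normrM normrX exprMn.
  rewrite [X in X <= _](_ : _ = (`|nbin a n| * `|s| ^+ n) * `|((m + n)`!%:R)^-1|);
    last by ring.
  apply: ler_pM; rewrite ?mulr_ge0 ?exprn_ge0//.
    by rewrite ler_wpM2r ?exprn_ge0// nbin_le.
  rewrite normfV ger0_norm ?ler0n// lef_pV2 ?posrE ?ltr0n ?fact_gt0//.
  by rewrite ler_nat leq_fact // leq_addl.
- exact: is_cvg_series_exp_coeff.
Qed.

(** Sums the identity f = u g + v X h of formal power series; the factor X shifts [h] by one
    index. *)
Lemma pseries_comb (f g h : R^nat) (u v : R) s :
  cvgn (pseries g s) -> cvgn (pseries h s) -> f 0%N = u * g 0%N ->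
  (forall j, f j.+1 = u * g j.+1 + v * h j) ->
  limn (pseries f s) = u * limn (pseries g s) + v * (s * limn (pseries h s)).
Proof.
move=> cg ch f0 fS; apply: cvg_lim => //; rewrite -cvg_shiftS /=.
rewrite [X in X @ _ --> _](_ : _ =
          (fun n => u * pseries g s n.+1 + v * (s * pseries h s n))); last first.
  apply/funext => n; rewrite /pseries /series /= !(big_nat_recl _ 0%N) //=.
  rewrite f0 mulrDr mulrA -addrA; congr (_ + _).
  rewrite !mulr_sumr -big_split /=; apply: eq_bigr => i _.
  by rewrite fS exprS; ring.
apply: cvgD; last by apply: cvgMl_tmp; exact: cvgMl_tmp.
apply: cvgMl_tmp; rewrite (cvg_shiftS (pseries g s)); exact: cg.
Qed.

Lemma pseries_const (f : R^nat) s :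
  (forall j, f j.+1 * s ^+ j.+1 = 0) -> limn (pseries f s) = f 0%N.
Proof.
move=> f0; apply: cvg_lim => //; rewrite -cvg_shiftS /=.
rewrite [X in X @ _ --> _](_ : _ = (fun=> f 0%N)); first exact: cvg_cst.
apply/funext => n; rewrite /pseries /series /= big_nat_recl //= expr0 mulr1.
by rewrite big1 ?addr0 // => i _; exact: f0.
Qed.

Lemma kummer0 a m : kummer a m 0 = (m`!%:R)^-1.
Proof.
rewrite /kummer pseries_const; first by rewrite /kcoef addn0 div1r.
by move=> j; rewrite expr0n mulr0.
Qed.

Lemma kummer0l m s : kummer 0 m s = (m`!%:R)^-1.
Proof.
rewrite /kummer pseries_const; first by rewrite /kcoef addn0 div1r.
move=> j; have h : (j.+1%:R : R) != 0 by rewrite pnatr_eq0.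
suff nb : nbin 0 j.+1 = 0 by rewrite /kcoef nb !mul0r.
by apply: (mulfI h); rewrite nbin_absorb oppr0 mul0r mulr0.
Qed.

(** Pascal's rule, summed; this is why [IplusT] lowers [a] by one in [kvec]. *)
Lemma kummer_shift a m s :
  kummer a m s = kummer (a + 1) m s + s * kummer (a + 1) m.+1 s.
Proof.
rewrite /kummer (@pseries_comb _ (kcoef (a + 1) m) (kcoef (a + 1) m.+1) 1 1).
- by rewrite !mul1r.
- exact: kcoef_cvg.
- exact: kcoef_cvg.
- by rewrite mul1r.
- by move=> j; rewrite !mul1r /kcoef addSnnS -mulrDl nbin_pascal.
Qed.

(** Since 1/(m+j)! = ((m+1) + j)/(m+1+j)!, each coefficient splits in two, and [nbin_absorb]
    rewrites the part carrying the factor j. *)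
Lemma kummer_contig c m s :
  kummer c m s = m.+1%:R * kummer c m.+1 s - c * (s * kummer (c + 1) m.+2 s).
Proof.
rewrite /kummer (@pseries_comb _ (kcoef c m.+1) (kcoef (c + 1) m.+2) m.+1%:R (- c)).
- by rewrite mulNr.
- exact: kcoef_cvg.
- exact: kcoef_cvg.
- rewrite /kcoef /= !addn0 factS natrM; field.
  by rewrite factR_neq0 nat1r pnatr_eq0.
- move=> j; rewrite /kcoef [- c * _]mulrA -nbin_absorb.
  have -> : (m + j.+1)%N = (m + j).+1 by rewrite addnS.
  have -> : (m.+1 + j.+1)%N = (m + j).+2 by rewrite addSn addnS.
  have -> : (m.+2 + j)%N = (m + j).+2 by rewrite !addSn.
  rewrite [(_.+2)`!]factS natrM.
  have h1 : ((m + j).+2%:R : R) != 0 by rewrite pnatr_eq0.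
  apply: (mulfI h1); rewrite (_ : (m + j).+2%:R = m.+1%:R + j.+1%:R);
    last by rewrite -natrD addSn addnS.
  field; rewrite factR_neq0 /=.
  by rewrite !nat1r -natrD pnatr_eq0 addSn.
Qed.

Lemma is_derive_kummer a m s :
  is_derive s (1 : R) (kummer a m) (- a * kummer (a + 1) m.+1 s).
Proof.
have diffsE b n : pseries_diffs (kcoef b n) = (fun j => - b * kcoef (b + 1) n.+1 j).
  apply/funext => j; rewrite /pseries_diffs /kcoef mulrA nbin_absorb.
  by rewrite addSnnS mulrA.
have scaleE b n u x : pseries (fun j => u * kcoef b n j) x =
    (fun k => u * pseries (kcoef b n) x k).
  apply/funext => k; rewrite /pseries /series /= mulr_sumr.
  by apply: eq_bigr => i _; rewrite mulrA.
have scale_cvg b n u x : cvgn (pseries (fun j => u * kcoef b n j) x).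
  by rewrite scaleE; apply: is_cvgMl_tmp; exact: kcoef_cvg.
have -> : - a * kummer (a + 1) m.+1 s = limn (pseries (pseries_diffs (kcoef a m)) s).
  rewrite diffsE scaleE; apply/esym/cvg_lim => //; apply: cvgMl_tmp; exact: kcoef_cvg.
apply: (@pseries_snd_diffs _ _ (`|s| + 1)).
- exact: kcoef_cvg.
- by rewrite diffsE.
- rewrite diffsE.
  (* The second derived series is again a multiple of a [kcoef] series, so its convergence also
     reduces to [kcoef_cvg]. *)
  have -> : pseries_diffs (fun j => - a * kcoef (a + 1) m.+1 j) =
     (fun j => (- a * - (a + 1)) * kcoef (a + 1 + 1) m.+2 j).
    apply/funext => j; rewrite /pseries_diffs /kcoef mulrCA -[RHS]mulrA.
    by congr (_ * _); rewrite mulrA nbin_absorb (addSnnS m.+1) mulrA.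
  exact: scale_cvg.
- by rewrite [`|_ + 1|]ger0_norm ?addr_ge0// ltrDl.
Qed.

(** The energy equals 1/m!^2 at 0. On |x| <= 1/2 its derivative is a nonpositive multiple of [a],
    and [a] has the sign of [s], so the energy does not grow on the way from 0 to [s]. *)
Lemma kummer_energy a m s : 0 <= a * s -> `|s| <= 2^-1 ->
  kummer a m s ^+ 2 + a * s * kummer (a + 1) m.+1 s ^+ 2 <= (m`!%:R)^-1 ^+ 2.
Proof.
move=> as0 s12.
pose y := kummer a m; pose Y := kummer (a + 1) m.+1.
pose U x := y x ^+ 2 + a * x * Y x ^+ 2.
pose dU x := a * Y x ^+ 2 * (1 - 2 * m.+1%:R - 2 * x).
have dUE (x : R) : is_derive x (1 : R) U (dU x).
  have dy := is_derive_kummer a m x; have dY := is_derive_kummer (a + 1) m.+1 x.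
  apply: is_derive_eq.
  (* The two identities express [y] through [Y] and the function of order [m.+2]; the latter also
     comes from the derivative of [Y], and its terms cancel. *)
  rewrite /dU /y /Y (kummer_shift a m x) (kummer_contig (a + 1) m x).
  rewrite /GRing.scale /=; ring.
have derU (x : R) : derivable U x 1 by case: (dUE x).
have U1E (x : R) : derive1 U x = dU x by rewrite derive1E; apply: derive_val.
have cU A : {within A, continuous U}.
  apply: continuous_subspaceT => x; apply: differentiable_continuous.
  exact/derivable1_diffP.
have -> : (m`!%:R)^-1 ^+ 2 = U 0 by rewrite /U /y kummer0 mulr0 mul0r addr0.
rewrite -/(U s).
have sgn (x : R) : `|x| <= 2^-1 -> 1 - 2 * m.+1%:R - 2 * x <= 0.
  rewrite ler_norml => /andP[x1 _]; rewrite -(natr1 m).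
  have := ler0n R m; lra.
case: (ltgtP s 0) => [s0|s0|->] //.
- apply: (@ger0_derive1_ndecr _ U s 0) => // [x xs|]; last by rewrite ltW.
  rewrite U1E /dU; have a0 : a <= 0 by nra.
  rewrite mulr_le0//; first by rewrite mulr_le0_ge0 ?sqr_ge0.
  apply: sgn; move: xs s12; rewrite in_itv/= => /andP[x1 x2].
  by rewrite !ler0_norm; lra.
- apply: (@ler0_derive1_nincr _ U 0 s) => // [x xs|]; last by rewrite ltW.
  rewrite U1E /dU; have a0 : 0 <= a by nra.
  rewrite mulr_ge0_le0//; first by rewrite mulr_ge0 ?sqr_ge0.
  apply: sgn; move: xs s12; rewrite in_itv/= => /andP[x1 x2].
  by rewrite !ger0_norm; lra.
Qed.

End Kummer.

(** * Norm estimates *)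

Section Norms.
Variables (R : realType) (K : numFieldType) (abs : K -> R).
Hypothesis abs_ge0 : forall x, 0 <= abs x.

Lemma nrm_ge0 (sp : seqspace R) (x : nat -> K) : 0 <= nrm abs sp x.
Proof.
case: sp => [p|] /=; first exact: powR_ge0.
have [ub|nub] := pselect (has_ubound (range (fun n => abs (x n)))).
  by apply: (le_trans (abs_ge0 (x 0%N))); apply: ub_le_sup => //; exists 0%N.
by rewrite sup_out // => -[].
Qed.

Lemma sum_half_le (n : nat) : \sum_(0 <= i < n) (2^-1 : R) ^+ i <= 2.
Proof.
suff -> : \sum_(0 <= i < n) (2^-1 : R) ^+ i = 2 - 2 * 2^-1 ^+ n.
  by rewrite gerBl mulr_ge0.
elim: n => [|n IH]; first by rewrite big_nil expr0 mulr1 subrr.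
by rewrite big_nat_recr //= IH exprS; field.
Qed.

Lemma half_pow_cvg0 (d : R) : (fun n => d * 2^-1 ^+ n) @ \oo --> (0 : R).
Proof.
apply: (@cvg_geometric R d 2^-1).
by rewrite ger0_norm // invf_lt1 // ltr1n.
Qed.

Lemma series_tail (u : R^nat) (N n : nat) :
  series (fun i => if (i < N)%N then 0 else u i) n =
  series u n - series u (minn n N).
Proof.
elim: n => [|n IH]; first by rewrite min0n subrr /series /= big_nil.
rewrite /series /= big_nat_recr //= -/(series _ n).
move: IH; rewrite /series /= => ->; rewrite [in RHS]big_nat_recr //=.
case: (ltnP n N) => nN.
  rewrite !(minn_idPl _) ?(ltnW nN)// addr0 big_nat_recr //=; ring.
rewrite !(minn_idPr _) ?(leqW nN)//; ring.
Qed.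

Lemma powRD_le (p a b : R) : 0 <= p -> 0 <= a -> 0 <= b ->
  (a + b) `^ p <= 2 `^ p * (a `^ p + b `^ p).
Proof.
move=> p0 a0 b0; wlog ab : a b a0 b0 / a <= b.
  move=> H; case: (leP a b) => [|/ltW] ab; first exact: H.
  by rewrite addrC (addrC (a `^ p)); exact: H.
apply: (@le_trans _ _ ((2 * b) `^ p)).
  by apply: ge0_ler_powR => //; rewrite ?nnegrE ?addr_ge0 ?mulr_ge0//; lra.
by rewrite powRM // ler_wpM2l ?powR_ge0// lerDr powR_ge0.
Qed.

(* Perturbing the tail of [x] by a geometric sequence: this replaces Minkowski's
   inequality in the density argument. *)
Lemma nrm_control (sp : seqspace R) (x : nat -> K) (eps : R) :
  space_ok sp -> inX abs sp x -> 0 < eps ->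
  exists N (d : R), 0 < d /\ forall y : nat -> K,
    (forall n, abs (y n) <= (if (n < N)%N then 0 else abs (x n)) + d * 2^-1 ^+ n) ->
    inX abs sp y /\ nrm abs sp y < eps.
Proof.
case: sp => [p|] /= spok xX eps0; last first.
  have e4 : 0 < eps / 4 by rewrite divr_gt0.
  have [N _ HN] : \forall n \near \oo, `|0 - abs (x n)| < eps / 4.
    by move/cvgrPdist_lt : xX; apply.
  have d2 (n : nat) : eps / 4 * 2^-1 ^+ n <= eps / 4.
    rewrite ger_pMr//; apply: exprn_ile1 => //; rewrite invf_le1 //; exact: ler1n.
  exists N, (eps / 4); split => // y yle; split.
    apply/cvgrPdist_lt => e e0; near=> n.
    rewrite sub0r normrN ger0_norm // (le_lt_trans (yle n))// ifF; last first.
      by apply/negbTE; rewrite -leqNgt; near: n; exact: nbhs_infty_ge.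
    rewrite (splitr e) ltrD //; near: n.
      have /cvgrPdist_lt/(_ (e / 2)) := xX.
      rewrite divr_gt0// => /(_ isT); apply: filterS => n.
      by rewrite sub0r normrN ger0_norm.
    have /cvgrPdist_lt/(_ (e / 2)) := half_pow_cvg0 (eps / 4).
    rewrite divr_gt0// => /(_ isT); apply: filterS => n.
    by rewrite sub0r normrN ger0_norm // mulr_ge0 // ltW.
  (* A bound on the terms bounds the supremum only weakly, hence the margin [eps / 2]. *)
  apply: (@le_lt_trans _ _ (eps / 2)); last by rewrite gtr_pMr// invf_lt1// ltr1n.
  apply: ge_sup; first by exists (abs (y 0%N)), 0%N.
  move=> _ [n _ <-]; apply: (le_trans (yle n)).
  have := d2 n; case: (ltnP n N) => nN; first by lra.
  have := HN n nN; rewrite sub0r normrN ger0_norm //; lra.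
have p0 : 0 < p by exact: lt_le_trans spok.
pose u n := abs (x n) `^ p; pose S := limn (series u).
have u0 n : 0 <= u n by exact: powR_ge0.
pose eta := (eps / 2) `^ p; have eta0 : 0 < eta by rewrite powR_gt0 ?divr_gt0.
pose c : R := 2 `^ p; have c0 : 0 < c by rewrite powR_gt0.
have [N _ HN] : \forall n \near \oo, `|S - series u n| < eta / c / 2.
  by move/cvgrPdist_lt : (xX); apply; rewrite !divr_gt0.
have und : nondecreasing_seq (series u) by exact: nondecreasing_series.
have uS n : series u n <= S by exact: nondecreasing_cvgn_le.
(* As [1 <= p], the bound [d <= 1] gives (d/2^n)^p <= d/2^n. The other bound keeps the geometric
   part of the sum below [eta / 2], the powers of 1/2 summing to at most 2. *)
pose d := Num.min 1 (eta / c / 4).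
have d0 : 0 < d by rewrite lt_min ltr01 !divr_gt0.
exists N, d; split => // y yle.
pose z n := abs (y n) `^ p.
have zle n : z n <= c * (if (n < N)%N then 0 else u n) + c * d * 2^-1 ^+ n.
  have dn0 : 0 < d * 2^-1 ^+ n by rewrite mulr_gt0 // exprn_gt0.
  apply: (@le_trans _ _ (((if (n < N)%N then 0 else abs (x n)) +
      d * 2^-1 ^+ n) `^ p)).
    apply: ge0_ler_powR; rewrite ?nnegrE ?(ltW p0)//.
    by rewrite addr_ge0 ?(ltW dn0)//; case: ifP.
  apply: (le_trans (powRD_le _ _ _)); rewrite ?(ltW p0) ?(ltW dn0)//.
    by case: ifP.
  rewrite -/c mulrDr -!(mulrA c); apply: lerD; rewrite ler_pM2l//.
    by case: ifP => // _; rewrite powR0 // gt_eqF.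
  apply: ge1r_powR => //; rewrite dn0 /=; apply: mulr_ile1; rewrite ?(ltW d0)//.
    by rewrite ge_min lexx.
  by apply: exprn_ile1 => //; rewrite invf_le1 // ler1n.
have serz n : series z n <= eta.
  apply: (@le_trans _ _ (c * series (fun i => if (i < N)%N then 0 else u i) n +
     c * d * \sum_(0 <= i < n) 2^-1 ^+ i)).
    by rewrite /series /= !mulr_sumr -big_split; apply: ler_sum => i _.
  apply: (@le_trans _ _ (c * (eta / c / 2) + c * (eta / c / 4) * 2)); last first.
    by rewrite le_eqVlt; apply/orP; left; apply/eqP; field; rewrite gt_eqF.
  apply: lerD.
    rewrite ler_pM2l// series_tail; case: (leqP n N) => nN.
      by rewrite subrr !divr_ge0 // ltW.
    have := HN N (leqnn N); rewrite ger0_norm ?subr_ge0// => h.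
    by have := uS n; lra.
  apply: ler_pM; rewrite ?sumr_ge0 ?sum_half_le ?mulr_ge0 ?(ltW c0) ?(ltW d0)//.
  by rewrite ler_pM2l// ge_min lexx orbT.
have zcvg : cvgn (series z).
  apply: nondecreasing_is_cvgn.
    by apply: nondecreasing_series => n _ _; exact: powR_ge0.
  by exists eta => _ [n _ <-].
split => //; apply: (@le_lt_trans _ _ (eps / 2)); last first.
  by rewrite gtr_pMr// invf_lt1// ltr1n.
have -> : eps / 2 = eta `^ p^-1.
  by rewrite -powRrM divff ?gt_eqF// powRr1// divr_ge0// ltW.
apply: ge0_ler_powR; rewrite ?invr_ge0 ?nnegrE ?(ltW p0) ?(ltW eta0)//.
  by apply: limr_ge => //; apply: nearW => n; apply: sumr_ge0 => i _; exact: powR_ge0.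
by apply: limr_le => //; exact: nearW.
Unshelve. all: by end_near. Qed.

End Norms.

(** * Orbits of I + T with controlled decay *)

Section Orbits.
Variables (R : realType) (K : numFieldType) (abs : K -> R) (iota : {rmorphism R -> K}).
Hypothesis abs_ge0 : forall x, 0 <= abs x.
Hypothesis abs_eq0 : forall x, abs x = 0 -> x = 0.
Hypothesis absM : forall x y, abs (x * y) = abs x * abs y.
Hypothesis absD : forall x y, abs (x + y) <= abs x + abs y.
Hypothesis abs_iota : forall r, abs (iota r) = `|r|.

Let seqK := nat -> K.

Lemma abs0 : abs 0 = 0.
Proof. by rewrite -(rmorph0 iota) abs_iota normr0. Qed.

Lemma abs1 : abs 1 = 1.
Proof. by rewrite -(rmorph1 iota) abs_iota normr1. Qed.

Lemma absN x : abs (- x) = abs x.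
Proof.
by rewrite -mulN1r absM -(rmorph1 iota) -rmorphN abs_iota normrN1 mul1r.
Qed.

Lemma abs_gt0 x : x != 0 -> 0 < abs x.
Proof.
move=> x0; rewrite lt_neqAle abs_ge0 andbT eq_sym.
by apply: contra x0 => /eqP/abs_eq0 ->.
Qed.

Lemma absV x : abs x^-1 = (abs x)^-1.
Proof.
have [->|x0] := eqVneq x 0; first by rewrite invr0 abs0 invr0.
have ax0 := abs_gt0 x0.
have ax1 : abs x != 0 by rewrite gt_eqF.
by apply: (mulfI ax1); rewrite -absM divff // abs1 divff.
Qed.

Lemma abs_prod (s : seq nat) (f : nat -> K) :
  abs (\prod_(j <- s) f j) = \prod_(j <- s) abs (f j).
Proof. exact: (big_morph abs absM abs1). Qed.

Variable w : seqK.
Hypothesis w_neq0 : forall n, (1 <= n)%N -> w n != 0.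

Definition wprod n : K := \prod_(1 <= j < n.+1) w j.

(** The quantity whose n-th root has positive lower limit in the growth hypothesis. *)
Definition wfact n : R := n`!%:R * abs (wprod n).

Lemma wprodS n : wprod n.+1 = wprod n * w n.+1.
Proof. by rewrite /wprod big_nat_recr. Qed.

Lemma wprod_neq0 n : wprod n != 0.
Proof.
elim: n => [|n IH]; first by rewrite /wprod big_nil oner_neq0.
by rewrite wprodS mulf_neq0 // w_neq0.
Qed.

Lemma wfact_gt0 n : 0 < wfact n.
Proof. by rewrite mulr_gt0 ?ltr0n ?fact_gt0 ?abs_gt0 ?wprod_neq0. Qed.

Variable eta : R.
Hypothesis eta_gt0 : 0 < eta.
Hypothesis eta_le : eta <= 2^-1.

(** A weighted sup bound that does not mention the space: orbits and approximations are controlled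
    in it first, and the norms of all the spaces are treated afterwards. *)
Definition gauge (C : R) (x : seqK) := forall n, wfact n * abs (x n) <= C * eta ^+ n.

Lemma gauge_lin C D a (x y : seqK) : gauge C x -> gauge D y ->
  gauge (abs a * C + D) (fun n => a * x n + y n).
Proof.
move=> gx gy n; have w0 := ltW (wfact_gt0 n).
apply: (@le_trans _ _ (abs a * (wfact n * abs (x n)) + wfact n * abs (y n))).
  rewrite mulrCA -mulrDr ler_wpM2l // (le_trans (absD _ _))// absM; exact: lexx.
rewrite mulrDl -mulrA lerD // ler_wpM2l //; exact: gx.
Qed.

Lemma gauge_le C D x : C <= D -> gauge C x -> gauge D x.
Proof.
by move=> CD gx n; rewrite (le_trans (gx n))// ler_wpM2r // exprn_ge0 // ltW.
Qed.

Let A := IplusT w.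

Lemma IplusT_lin a (x y : seqK) :
  A (fun n => a * x n + y n) = (fun n => a * A x n + A y n).
Proof. by apply/funext => n; rewrite /A /IplusT /bwshift; ring. Qed.

(** The difference [d] is killed by I + T, so [wprod n * d n] has constant modulus; the gauge bounds
    this modulus by a multiple of [eta ^+ n], as n! >= 1. *)
Lemma IplusT_inj C (x y : seqK) : gauge C (fun n => - 1 * x n + y n) ->
  A x = A y -> x = y.
Proof.
set d := (fun n => _) => gd Axy.
have Ad n : d n + w n.+1 * d n.+1 = 0.
  have /(congr1 (fun f => f n)) := Axy.
  rewrite /A /IplusT /bwshift /d => h.
  by rewrite -(subrr (y n + w n.+1 * y n.+1)) -{2}h; ring.
have dE n : abs (wprod n) * abs (d n) = abs (d 0%N).
  elim: n => [|n <-]; first by rewrite /wprod big_nil abs1 mul1r.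
  rewrite wprodS absM -mulrA -absM; congr (_ * _).
  by rewrite -(absN (d n)); congr abs; apply/eqP; rewrite -addr_eq0 addrC Ad.
have d0 : abs (d 0%N) <= 0.
  have cv := half_pow_cvg0 `|C|; rewrite -(cvg_lim _ cv)//.
  apply: limr_ge; [exact: cvgP cv | apply: nearW => n].
  rewrite -(dE n); apply: (@le_trans _ _ (wfact n * abs (d n))).
    rewrite /wfact -mulrA ler_peMl ?mulr_ge0//.
    by rewrite ler1n fact_gt0.
  apply: (le_trans (gd n)); apply: (@le_trans _ _ (`|C| * eta ^+ n)).
    by rewrite ler_wpM2r ?ler_norm// exprn_ge0 // ltW.
  by rewrite ler_wpM2l // lerXn2r // nnegrE // ltW.
apply/funext => n; have : abs (wprod n) * abs (d n) = 0.
  by rewrite dE; apply/eqP; rewrite eq_le d0 abs_ge0.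
move/eqP; rewrite mulf_eq0 gt_eqF ?abs_gt0 ?wprod_neq0//= => /eqP/abs_eq0.
by rewrite /d mulN1r => /eqP; rewrite addrC subr_eq0 => /eqP ->.
Qed.

(** * Forward and backward orbits decaying like 1 / sqrt k in the gauge *)

Definition rate k : R := (Num.sqrt k.+1%:R)^-1.

Lemma rate_ge0 k : 0 <= rate k.
Proof. by rewrite invr_ge0 sqrtr_ge0. Qed.

Definition decays (z : nat -> seqK) := exists C, forall k, gauge (C * rate k) (z k).

Lemma decays_lin a z z' : decays z -> decays z' ->
  decays (fun k n => a * z k n + z' k n).
Proof.
move=> [C hC] [D hD]; exists (abs a * C + D) => k.
rewrite mulrDl -mulrA; exact: gauge_lin.
Qed.

Definition forward_set : set seqK := [set x | decays (fun k => iter k A x)].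

Definition backward_orbit (x : seqK) (z : nat -> seqK) :=
  [/\ z 0%N = x, forall k, A (z k.+1) = z k & decays z].

Definition backward_set : set seqK := [set x | exists z, backward_orbit x z].

Definition lin_closed (V : set seqK) :=
  V (fun=> 0) /\ forall a x y, V x -> V y -> V (fun n => a * x n + y n).

Lemma decays0 : decays (fun _ _ => 0).
Proof. by exists 0 => k n; rewrite abs0 mulr0 !mul0r. Qed.

Lemma IplusT0 : A (fun=> 0) = (fun=> 0).
Proof. by apply/funext => n; rewrite /A /IplusT /bwshift mulr0 addr0. Qed.

Lemma forward_lin : lin_closed forward_set.
Proof.
split.
  rewrite /forward_set /=; suff -> : (fun k => iter k A (fun=> 0)) = (fun _ _ => 0).
    exact: decays0.
  by apply/funext; elim=> [//|k IH]; rewrite iterS IH IplusT0.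
move=> a x y Vx Vy; rewrite /forward_set /=.
suff -> : (fun k => iter k A (fun n => a * x n + y n)) =
          (fun k n => a * iter k A x n + iter k A y n) by exact: decays_lin.
by apply/funext; elim=> [//|k IH]; rewrite iterS IH IplusT_lin.
Qed.

Lemma backward_lin : lin_closed backward_set.
Proof.
split.
  exists (fun _ _ => 0); split => [|k|]; rewrite ?IplusT0 //; exact: decays0.
move=> a x y [z [z0 zA zd]] [z' [z0' zA' zd']].
exists (fun k n => a * z k n + z' k n); split; first by rewrite z0 z0'.
  by move=> k; rewrite IplusT_lin zA zA'.
exact: decays_lin.
Qed.

Lemma backward_orbit_uniq x z z' :
  backward_orbit x z -> backward_orbit x z' -> z = z'.
Proof.
move=> [z0 zA zd] [z0' zA' zd']; apply/funext; elim=> [|k IH]; first by rewrite z0 z0'.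
have [C hC] := decays_lin (- 1) zd zd'.
by apply: IplusT_inj (hC k.+1) _; rewrite zA zA'.
Qed.

(** An orbit is picked by choice; [backward_orbit_uniq] makes the pick immaterial. Points without a
    backward orbit get the default value [x]. *)
Definition backward_step (x : seqK) : seqK :=
  if pselect (exists z, backward_orbit x z) is left h then sval (cid h) 1%N else x.

Lemma backward_stepE x z : backward_orbit x z -> backward_step x = z 1%N.
Proof.
move=> xz; rewrite /backward_step; case: pselect => [h|[]]; last by exists z.
by case: cid => z' /= /(backward_orbit_uniq xz) ->.
Qed.

Lemma backward_orbit_shift x z j : backward_orbit x z ->
  backward_orbit (z j) (fun k => z (j + k)%N).
Proof.
move=> [z0 zA [C hC]]; split; first by rewrite addn0.
  by move=> k; rewrite addnS zA.
(* The rate at [j + k] is at most the rate at [k], which helps only with a nonnegative constant in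
   front. *)
exists `|C| => k; apply: gauge_le (hC _).
apply: (@le_trans _ _ (`|C| * rate (j + k))).
  by rewrite ler_wpM2r ?rate_ge0 ?ler_norm.
rewrite ler_wpM2l // lef_pV2 ?posrE ?sqrtr_gt0 ?ltr0n//.
by rewrite ler_wsqrtr // ler_nat ltnS leq_addl.
Qed.

Lemma iter_backward_step x z k : backward_orbit x z -> iter k backward_step x = z k.
Proof.
move=> xz; elim: k => [|k IH]; first by case: xz.
rewrite iterS IH (backward_stepE (backward_orbit_shift k xz)).
by rewrite addn1.
Qed.

(** * Explicit orbits from Kummer functions *)

Definition kvec (t a : R) : seqK :=
  fun n => iota (t ^+ n.+1 * kummer a n.+1 t) / wprod n.

Lemma IplusT_kvec t a : A (kvec t (a + 1)) = kvec t a.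
Proof.
apply/funext => m; rewrite /A /IplusT /bwshift /kvec (kummer_shift a).
rewrite wprodS; set y := kummer _ _ _; set Y := kummer _ _ _.
have wm := wprod_neq0 m; have wm1 : w m.+1 != 0 by exact: w_neq0.
have -> : t ^+ m.+1 * (y + t * Y) = t ^+ m.+1 * y + t ^+ m.+2 * Y.
  by rewrite [t ^+ m.+2]exprS; ring.
rewrite rmorphD /=.
by field; apply/andP.
Qed.

Lemma kvec_gauge t a k : t != 0 -> `|t| <= eta ->
  (forall n, k.+1%:R * `|t| * kummer a n.+1 t ^+ 2 <= 2 * (n`!%:R^-1) ^+ 2) ->
  gauge (rate k) (kvec t a).
Proof.
move=> t0 tle hk n; have t0' : 0 < `|t| by rewrite normr_gt0.
have f0 : (0 : R) < n`!%:R by rewrite ltr0n fact_gt0.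
rewrite /wfact /kvec absM absV abs_iota.
rewrite [X in X <= _](_ : _ = n`!%:R * `|t ^+ n.+1 * kummer a n.+1 t|); last first.
  by field; rewrite gt_eqF // abs_gt0 // wprod_neq0.
apply: (@le_trans _ _ (rate k * `|t| ^+ n)); last first.
  by rewrite ler_wpM2l ?rate_ge0// lerXn2r // nnegrE // ltW.
have s0 : 0 < Num.sqrt (k.+1%:R : R) by rewrite sqrtr_gt0 ltr0n.
rewrite /rate [leRHS]mulrC ler_pdivlMr // -ler_sqr ?nnegrE ?exprn_ge0 ?mulr_ge0 ?(ltW s0)//.
have h := hk n; set y := kummer _ _ _ in h *.
rewrite 2!exprMn sqr_sqrtr // real_normK ?num_real// exprMn.
have -> : (t ^+ n.+1) ^+ 2 = `|t| ^+ 2 * (`|t| ^+ n) ^+ 2.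
  by rewrite -[LHS]real_normK ?num_real// normrX (exprS `|t| n) exprMn.
set T := `|t|; set P := (T ^+ n) ^+ 2.
have P0 : 0 <= P by exact: sqr_ge0.
(* After squaring, [hk] is multiplied by n!^2 |t|^(2n+1). This leaves a factor [2 * T], at most 1
   because [eta <= 2^-1]. *)
apply: (@le_trans _ _ (n`!%:R ^+ 2 * T * P * (2 * n`!%:R^-1 ^+ 2))).
  rewrite [X in X <= _](_ : _ = n`!%:R ^+ 2 * T * P * (k.+1%:R * T * y ^+ 2)); last by ring.
  by rewrite ler_wpM2l // mulr_ge0 // mulr_ge0 ?sqr_ge0// ltW.
rewrite [X in X <= _](_ : _ = 2 * T * P); last by field; rewrite gt_eqF.
rewrite ler_piMl //; have : T <= eta by [].
by have := eta_le; lra.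
Qed.

(** For [a = - k.+1%:R] the left-hand side is the second term of the energy of order [n]. *)
Lemma kummer_forward_bound k n t : t < 0 -> `|t| <= eta ->
  k.+1%:R * `|t| * kummer (- k%:R) n.+1 t ^+ 2 <= 2 * (n`!%:R^-1) ^+ 2.
Proof.
move=> t0 te; have t12 := le_trans te eta_le.
have as0 : 0 <= - k.+1%:R * t by rewrite mulNr oppr_ge0 pmulr_rle0 ?ltr0n// ltW.
have := kummer_energy n as0 t12.
have -> : - k.+1%:R + 1 = - k%:R :> R by rewrite -(natr1 k); ring.
rewrite ltr0_norm // mulNr mulrN => h.
have := sqr_ge0 (kummer (- k.+1%:R) n t); have := sqr_ge0 (n`!%:R^-1 : R).
by move: h; lra.
Qed.

(** Write k+1 = (k-1) + 2. The energy with parameter k-1 and order [n] bounds the first part by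
    1/n!^2. As 2t <= 1, the second part is at most y^2, which the energy with parameter k and order
    [n.+1] bounds. *)
Lemma kummer_backward_bound k n t : 0 < t -> `|t| <= eta ->
  k.+1%:R * `|t| * kummer k%:R n.+1 t ^+ 2 <= 2 * (n`!%:R^-1) ^+ 2.
Proof.
move=> t0 te; have t12 := le_trans te eta_le.
have fS : (n.+1`!%:R^-1 : R) ^+ 2 <= n`!%:R^-1 ^+ 2.
  rewrite lerXn2r ?nnegrE// lef_pV2 ?posrE ?ltr0n ?fact_gt0//.
  by rewrite ler_nat leq_fact.
have h1 : kummer k%:R n.+1 t ^+ 2 <= n`!%:R^-1 ^+ 2.
  have as0 : 0 <= k%:R * t by rewrite mulr_ge0 // ltW.
  have := kummer_energy n.+1 as0 t12.
  have := mulr_ge0 as0 (sqr_ge0 (kummer (k%:R + 1) n.+2 t)); lra.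
rewrite gtr0_norm //; move: t12; rewrite gtr0_norm // => t12.
set y := kummer _ _ _ in h1 *; have y0 : 0 <= y ^+ 2 by exact: sqr_ge0.
have h2 : (k%:R - 1) * t * y ^+ 2 <= n`!%:R^-1 ^+ 2.
  (* For k = 0 the parameter k-1 has the wrong sign for the energy, but the left-hand side is then
     nonpositive. *)
  case: k @y h1 y0 => [|k] y h1 y0.
    apply: (@le_trans _ _ 0); last exact: sqr_ge0.
    by rewrite mulr_le0_ge0// mulr_le0_ge0 ?(ltW t0)//; lra.
  have as0 : 0 <= k%:R * t by rewrite mulr_ge0 // ltW.
  have := @kummer_energy _ k%:R n t as0; rewrite gtr0_norm // => /(_ t12).
  rewrite natr1 -/y (_ : k.+1%:R - 1 = k%:R); last by rewrite -natr1 addrK.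
  by have := sqr_ge0 (kummer k%:R n t); lra.
have h3 : t * y ^+ 2 <= 2^-1 * y ^+ 2 by rewrite ler_wpM2r.
by move: h2; rewrite -(natr1 k); lra.
Qed.

Lemma kvec_forward t : t < 0 -> `|t| <= eta -> forward_set (kvec t 0).
Proof.
move=> t0 te; exists 1 => k; rewrite mul1r.
have -> : iter k A (kvec t 0) = kvec t (- k%:R).
  elim: k => [|k IH]; first by rewrite oppr0.
  rewrite iterS IH -[RHS]IplusT_kvec; congr (A (kvec t _)).
  by rewrite -(natr1 k); ring.
by apply: kvec_gauge => [||n]; [rewrite lt_eqF | exact: te | exact: kummer_forward_bound].
Qed.

Lemma kvec_backward t : 0 < t -> `|t| <= eta -> backward_set (kvec t 0).
Proof.
move=> t0 te; exists (fun k => kvec t k%:R); split => [//|k|].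
  by rewrite -natr1 IplusT_kvec.
exists 1 => k; rewrite mul1r.
by apply: kvec_gauge => [||n]; [rewrite gt_eqF | exact: te | exact: kummer_backward_bound].
Qed.

(** * Density, by approximation in the gauge *)

Definition gauge_closure (V : set seqK) (x : seqK) := forall eps, 0 < eps ->
  exists2 e, V e & gauge eps (fun n => x n - e n).

Section Density.
Variable V : set seqK.
Hypothesis V_lin : lin_closed V.
Let cl := gauge_closure V.

Lemma gauge_closure0 : cl (fun=> 0).
Proof.
move=> eps eps0; exists (fun=> 0); first by case: V_lin.
by move=> n; rewrite subrr abs0 mulr0 mulr_ge0 // ?exprn_ge0 // ltW.
Qed.

Lemma gauge_closure_lin a x y : cl x -> cl y -> cl (fun n => a * x n + y n).
Proof.
move=> clx cly eps eps0; have a1 : 0 < abs a + 1 by rewrite ltr_wpDl.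
have [e Ve xe] := clx (eps / 2 / (abs a + 1)) ltac:(by rewrite !divr_gt0).
have [f Vf yf] := cly (eps / 2) ltac:(by rewrite !divr_gt0).
exists (fun n => a * e n + f n); first exact: V_lin.2.
have -> : (fun n => a * x n + y n - (a * e n + f n)) =
          (fun n => a * (x n - e n) + (y n - f n)) by apply/funext => n; ring.
apply: gauge_le (gauge_lin a xe yf).
rewrite [X in _ <= X](splitr eps) lerD2r mulrCA ger_pMr ?divr_gt0//.
by rewrite ler_pdivrMr // mul1r lerDl.
Qed.

(** Lets basis vectors be approximated from the closure, which already contains the earlier ones,
    instead of from [V]. *)
Lemma gauge_closure_idem x :
  (forall eps, 0 < eps -> exists2 y, cl y & gauge eps (fun n => x n - y n)) -> cl x.
Proof.
move=> H eps eps0; have e2 : 0 < eps / 2 by rewrite divr_gt0.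
have [y cly xy] := H _ e2; have [e Ve ye] := cly _ e2.
exists e => //; have := gauge_lin 1 xy ye; rewrite abs1 mul1r -splitr.
by congr gauge; apply/funext => n; ring.
Qed.

Hypothesis V_kvec : forall d, 0 < d -> exists t, [/\ t != 0, `|t| <= d & V (kvec t 0)].

Definition basis_vec N : seqK := fun n => (n == N)%:R.

(** Strong induction: drop the first N coordinates of [kvec t 0], using earlier basis vectors, and
    rescale by [c] so that coordinate N becomes 1. The later coordinates carry a further factor [t]
    and vanish as t tends to 0. *)
Lemma gauge_closure_basis N : cl (basis_vec N).
Proof.
elim/ltn_ind: N => N IH; apply: gauge_closure_idem => eps eps0.
pose M := N.+1`!%:R * abs (wprod N).
have M0 : 0 < M by rewrite mulr_gt0 ?ltr0n ?fact_gt0 ?abs_gt0 ?wprod_neq0.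
(* Coordinate r+N+1 of the error has weighted size at most M |t|^(r+1): the second bound on [t]
   absorbs [M * |t|], and [eta] the remaining |t|^r. *)
have [|t [t0 tle Vt]] := V_kvec (d := Num.min eta (eps * eta ^+ N.+1 / M)).
  by rewrite lt_min eta_gt0 divr_gt0// mulr_gt0 // exprn_gt0.
move: tle; rewrite le_min => /andP[te tM].
pose c := iota (N.+1`!%:R / t ^+ N.+1) * wprod N.
have cltail m : (m <= N)%N -> cl (fun n => if (n < m)%N then 0 else kvec t 0 n).
  elim: m => [|m IHm] mN.
    move=> e e0; exists (kvec t 0) => // n.
    by rewrite subrr abs0 mulr0 mulr_ge0 ?exprn_ge0// ltW.
  rewrite [X in cl X](_ : _ = (fun n => - kvec t 0 m * basis_vec m n +
      (if (n < m)%N then 0 else kvec t 0 n))).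
    by apply: gauge_closure_lin; [exact: IH | apply: IHm; exact: ltnW].
  apply/funext => n; rewrite /basis_vec ltnS leq_eqVlt.
  case: eqVneq => [->|] /=; first by rewrite ltnn mulr1 addNr.
  by rewrite mulr0 add0r.
exists (fun n => c * (if (n < N)%N then 0 else kvec t 0 n) + 0).
  by apply: gauge_closure_lin gauge_closure0; exact: cltail.
have kE n : kvec t 0 n = iota (t ^+ n.+1 / n.+1`!%:R) / wprod n.
  by rewrite /kvec kummer0l.
have tN0 m : t ^+ m != 0 by rewrite expf_neq0.
move=> n; rewrite addr0 /basis_vec; case: (ltngtP n N) => nN.
- by rewrite mulr0 subr0 abs0 mulr0 mulr_ge0 ?exprn_ge0// ltW.
- have [r nE] : exists r, n = (r + N.+1)%N by exists (n - N.+1)%N; rewrite subnK.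
  rewrite sub0r absN kE !absM absV !abs_iota /wfact {nN}nE.
  have W0 : abs (wprod (r + N.+1)) != 0 by rewrite gt_eqF // abs_gt0 // wprod_neq0.
  rewrite !normrM !normfV !normr_nat !normrX.
  have tT m : `|t| ^+ m != 0 by rewrite expf_neq0 // normr_eq0.
  have -> : `|t| ^+ (r + N.+1).+1 = `|t| * `|t| ^+ r * `|t| ^+ N.+1.
    by rewrite exprS exprD mulrA.
  rewrite [(r + N.+1).+1`!]factS natrM.
  rewrite [X in X <= _](_ : _ = M * `|t| * `|t| ^+ r / (r + N.+1).+1%:R); last first.
    have : ((r + N.+1).+1%:R : R) != 0 by rewrite pnatr_eq0.
    rewrite /M; move: (_.+1%:R : R) => D D0.
    by field; rewrite tT W0 factR_neq0 D0.
  rewrite ler_pdivrMr ?ltr0n//; apply: (@le_trans _ _ (eps * eta ^+ (r + N.+1))).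
    rewrite [X in _ <= _ * X]exprD [X in _ <= _ * X]mulrC mulrA.
    rewrite ler_pM ?mulr_ge0 ?exprn_ge0 ?(ltW M0)//.
      by rewrite mulrC -ler_pdivlMr.
    by rewrite lerXn2r // nnegrE // ltW.
  by rewrite ler_peMr ?ler1n// mulr_ge0 ?exprn_ge0// ltW.
- rewrite nN kE /c [X in abs X](_ : _ = 0).
    by rewrite abs0 mulr0 mulr_ge0 ?exprn_ge0// ltW.
  rewrite mulrAC mulrA -rmorphM /= mulrA.
  have -> : N.+1`!%:R / t ^+ N.+1 * t ^+ N.+1 / N.+1`!%:R = 1 :> R.
    by field; rewrite tN0 factR_neq0.
  by rewrite rmorph1 mul1r mulVf ?subrr// wprod_neq0.
Qed.

Lemma gauge_closure_trunc (x : seqK) N : cl (fun n => if (n < N)%N then x n else 0).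
Proof.
elim: N => [|N IH]; first exact: gauge_closure0.
rewrite [X in cl X](_ : _ = (fun n => x N * basis_vec N n +
    (if (n < N)%N then x n else 0))).
  by apply: gauge_closure_lin => //; exact: gauge_closure_basis.
apply/funext => n; rewrite /basis_vec ltnS leq_eqVlt.
case: eqVneq => [->|] /=; first by rewrite ltnn mulr1 addr0.
by rewrite mulr0 add0r.
Qed.

End Density.

(** * From the gauge to the norms, and the Kitai Criterion *)

Section Kitai.
Variables (sp : seqspace R) (c : R).
Hypothesis sp_ok : space_ok sp.
Hypothesis c_gt0 : 0 < c.
Hypothesis wfact_ge : forall n, c * (2 * eta) ^+ n <= wfact n.

(** The factor 2 in [wfact_ge] leaves 2^-n after division, the form that [nrm_control] accepts. *)
Lemma gauge_geometric d x n : gauge (c * d) x -> abs (x n) <= d * 2^-1 ^+ n.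
Proof.
move=> /(_ n) gx; have en : 0 < eta ^+ n by rewrite exprn_gt0.
have cn : 0 < c * (2 * eta) ^+ n by rewrite mulr_gt0 // exprn_gt0 // mulr_gt0.
have : c * (2 * eta) ^+ n * abs (x n) <= c * d * eta ^+ n.
  by apply: le_trans gx; rewrite ler_wpM2r.
rewrite mulrC -ler_pdivlMr //; congr (_ <= _).
by rewrite exprVn exprMn; field; rewrite !gt_eqF// exprn_gt0.
Qed.

Lemma inX0 : inX abs sp (fun=> 0).
Proof.
case: sp sp_ok => [p|] /= spok; last by rewrite abs0; exact: cvg_cst.
have p0 : p != 0 by rewrite gt_eqF // (lt_le_trans ltr01).
rewrite (_ : series _ = (fun=> 0)); first exact: is_cvg_cst.
by apply/funext => n; rewrite /series /= big1 // => i _; rewrite abs0 powR0.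
Qed.

(** This is [nrm_control] around the zero sequence. *)
Lemma gauge_small eps : 0 < eps -> exists2 d, 0 < d &
  forall y, gauge d y -> inX abs sp y /\ nrm abs sp y < eps.
Proof.
move=> eps0; have [N [d [d0 H]]] := nrm_control abs_ge0 sp_ok inX0 eps0.
exists (c * d); first exact: mulr_gt0.
move=> y gy; apply: H => n; rewrite abs0 if_same add0r; exact: gauge_geometric.
Qed.

Lemma rate_small C d : 0 < d -> \forall k \near \oo, C * rate k <= d.
Proof.
move=> d0; near=> k.
apply: (@le_trans _ _ (`|C| * rate k)).
  by rewrite ler_wpM2r ?rate_ge0 ?ler_norm.
rewrite /rate ler_pdivrMr ?sqrtr_gt0 ?ltr0n// mulrC -ler_pdivrMr//.
rewrite -[leLHS]ger0_norm ?divr_ge0 ?(ltW d0)// -sqrtr_sqr ler_wsqrtr //.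
near: k; apply: filterS (nbhs_infty_ger ((`|C| / d) ^+ 2)) => k h.
by apply: (le_trans h); rewrite ler_nat.
Unshelve. all: by end_near. Qed.

Lemma decays_tends0 z : decays z -> tends0 abs sp z.
Proof.
move=> [C hC]; apply/cvgrPdist_lt => eps eps0.
have [d d0 H] := gauge_small eps0.
apply: filterS (rate_small C d0) => k Ck.
rewrite sub0r normrN ger0_norm ?nrm_ge0//.
by apply: (H _ _).2; apply: gauge_le (hC k).
Qed.

Lemma inX_scale a x : inX abs sp x -> inX abs sp (fun n => a * x n).
Proof.
case: sp => [p|] /= xX.
  have -> : (fun n => abs (a * x n) `^ p) = abs a `^ p *: (fun n => abs (x n) `^ p).
    by apply/funext => n; rewrite absM powRM.
  exact: is_cvg_seriesZ.
rewrite [X in X @ _](_ : _ = (fun n => abs a * abs (x n))); last first.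
  by apply/funext => n; rewrite absM.
by rewrite -[X in _ --> X](mulr0 (abs a)); exact: cvgMl_tmp.
Qed.

(** [gauge_small] covers only sequences of small gauge, so the point is scaled down by [a] and then
    back. *)
Lemma decays_inX z : decays z -> inX abs sp (z 0%N).
Proof.
move=> [C hC]; have [d d0 H] := gauge_small ltr01.
pose a := iota (d / (`|C * rate 0| + 1)).
have q0 : 0 < `|C * rate 0| + 1 by rewrite ltr_wpDl.
have a0 : a != 0 by rewrite fmorph_eq0 gt_eqF // divr_gt0.
have -> : z 0%N = (fun n => a^-1 * (a * z 0%N n + 0)).
  by apply/funext => n; rewrite addr0 mulKf.
apply: inX_scale; apply: (H _ _).1.
have g0 : gauge 0 (fun=> 0) by move=> n; rewrite abs0 mulr0 mul0r.
apply: gauge_le (gauge_lin a (hC 0%N) g0); rewrite addr0 abs_iota.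
rewrite ger0_norm ?divr_ge0 ?(ltW d0) ?(ltW q0)//.
rewrite mulrAC ler_pdivrMr // ler_wpM2l ?(ltW d0)//.
by rewrite (le_trans (ler_norm _)) // lerDl.
Qed.

(** Only a truncation of [x] is approximated from [V]; the discarded tail and the geometric error
    together match the hypothesis of [nrm_control]. *)
Lemma dense_in_kvec V : lin_closed V -> (forall x, V x -> inX abs sp x) ->
  (forall d, 0 < d -> exists t, [/\ t != 0, `|t| <= d & V (kvec t 0)]) ->
  dense_in abs sp V.
Proof.
move=> Vlin VX Vk; split => // x xX eps eps0.
have [N [d [d0 H]]] := nrm_control abs_ge0 sp_ok xX eps0.
have [e Ve ge] := gauge_closure_trunc Vlin Vk x N (mulr_gt0 c_gt0 d0).
exists e; split => //; apply: (H _ _).2 => n.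
have -> : seqsub x e n = (if (n < N)%N then 0 else x n) +
   ((if (n < N)%N then x n else 0) - e n).
  by rewrite /seqsub; case: ifP => _; ring.
apply: (le_trans (absD _ _)); apply: lerD; last exact: (gauge_geometric n ge).
by case: ifP => // _; rewrite abs0.
Qed.

Lemma Kitai_IplusT : Kitai abs sp A.
Proof.
(* Capping by [eta] meets the smallness condition on t; negative t will serve forward orbits and
   positive t backward ones. *)
have min_eta d : 0 < d -> 0 < Num.min d eta by move=> d0; rewrite lt_min d0 eta_gt0.
exists forward_set, backward_set, backward_step; split; [|split; [|split; [|split]]].
- apply: dense_in_kvec; first exact: forward_lin.
    by move=> x; exact: decays_inX.
  move=> d /min_eta d0; exists (- Num.min d eta); split.
  + by rewrite oppr_eq0 gt_eqF.
  + by rewrite normrN gtr0_norm // ge_min lexx.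
  + by apply: kvec_forward; rewrite ?oppr_lt0// normrN gtr0_norm // ge_min lexx orbT.
- apply: dense_in_kvec; first exact: backward_lin.
    by move=> x [z [<- _ /decays_inX]].
  move=> d /min_eta d0; exists (Num.min d eta); split.
  + by rewrite gt_eqF.
  + by rewrite gtr0_norm // ge_min lexx.
  + by apply: kvec_backward; rewrite // gtr0_norm // ge_min lexx orbT.
- move=> y [z yz]; rewrite /backward_set /= (backward_stepE yz).
  by exists (fun k => z (1 + k)%N); exact: backward_orbit_shift yz.
- move=> y [z yz]; rewrite (backward_stepE yz).
  by case: yz => <- zA _; exact: zA.
split.
- move=> y [z yz]; rewrite (_ : (fun k => _) = z).
    by case: yz => _ _; exact: decays_tends0.
  by apply/funext => k; exact: iter_backward_step.
- by move=> x; exact: decays_tends0.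
Qed.

End Kitai.

End Orbits.

(** * The growth hypothesis *)

Lemma pos_finite_lower_bound (R : realType) (g : nat -> R) N :
  (forall n, 0 < g n) -> exists2 c, 0 < c & forall n, (n < N)%N -> c <= g n.
Proof.
move=> g0; elim: N => [|N [c c0 IH]]; first by exists 1.
exists (Num.min c (g N)); first by rewrite lt_min c0 g0.
move=> n; rewrite ltnS leq_eqVlt => /orP[/eqP->|/IH nc]; rewrite ge_min ?lexx ?orbT//.
by rewrite nc.
Qed.

(** The lower limit is the supremum of the tail infima, so one of these is already positive. *)
Lemma limn_einf_gt0 (R : realType) (u : R^nat) :
  (0 < limn_einf (fun n => (u n)%:E))%E ->
  exists2 r, 0 < r & exists N, forall n, (N <= n)%N -> r <= u n.
Proof.
rewrite limn_einf_lim; have /cvg_lim -> // := @cvg_einfs_sup _ (EFin \o u).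
move=> /ereal_sup_gt[_ [N _ <-]] u0.
have lb n : (N <= n)%N -> (einfs (fun n => (u n)%:E) N <= (u n)%:E)%E.
  by move=> Nn; apply: ereal_inf_lbound; exists n.
move: u0 lb; case: (einfs _ N) => [r||] //= r0 lb.
  by exists r; [rewrite -lte_fin | exists N => n /lb; rewrite lee_fin].
(* An infinite tail infimum contradicts the finiteness of the terms. *)
by exists 1 => //; exists N => n /lb; rewrite leNgt ltry.
Qed.

Lemma growth_lower_bound (R : realType) (g : R^nat) : (forall n, 0 < g n) ->
  (0 < limn_einf (fun n => (g n `^ n%:R^-1)%:E))%E ->
  exists r c, [/\ 0 < r, 0 < c & forall n, c * r ^+ n <= g n].
Proof.
move=> g0 /limn_einf_gt0[r r0 [N HN]].
have gr0 n : 0 < g n / r ^+ n by rewrite divr_gt0 // exprn_gt0.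
(* The initial block reaches up to N, so it always contains n = 0, where the root has exponent 0 and
   carries no information on [g 0]. *)
have [c c0 Hc] := pos_finite_lower_bound N.+1 gr0.
exists r, (Num.min 1 c); split => // [|n]; first by rewrite lt_min ltr01.
have rn0 : 0 < r ^+ n by rewrite exprn_gt0.
rewrite -ler_pdivlMr // ge_min; apply/orP.
case: (ltnP n N.+1) => nN; [right; exact: Hc | left].
rewrite ler_pdivlMr // mul1r.
have n0 : n%:R != 0 :> R by rewrite pnatr_eq0 -lt0n (leq_ltn_trans _ nN).
have -> : g n = (g n `^ n%:R^-1) ^+ n.
  by rewrite -powR_mulrn ?powR_ge0// -powRrM mulVf// powRr1 // ltW.
rewrite lerXn2r ?nnegrE ?powR_ge0 ?(ltW r0)//; exact/HN/ltnW.
Qed.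

(** Real and complex scalars share one proof, through a multiplicative modulus and an isometric
    embedding of the reals. *)
Lemma theorem_for_abs (R : realType) (K : numFieldType) (abs : K -> R)
  (iota : {rmorphism R -> K}) :
  (forall x, 0 <= abs x) -> (forall x, abs x = 0 -> x = 0) ->
  (forall x y, abs (x * y) = abs x * abs y) ->
  (forall x y, abs (x + y) <= abs x + abs y) ->
  (forall r, abs (iota r) = `|r|) -> theorem_for abs.
Proof.
move=> abs_ge0 abs_eq0 absM absD abs_iota sp w sp_ok [w0 _] gw.
have wf0 := wfact_gt0 abs_ge0 abs_eq0 w0.
have [|r [c [r0 c0 Hr]]] := growth_lower_bound wf0.
  rewrite [X in limn_einf X](_ : _ = fun n => ((n`!%:R *
    \prod_(1 <= j < n.+1) abs (w j)) `^ n%:R^-1)%:E) //.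
  by apply/funext => n; rewrite /wfact (abs_prod absM abs_iota).
(* This [eta] satisfies both [2 * eta <= r], for the lower bound on [wfact], and [eta <= 2^-1], for
   the energy estimate. *)
have eta0 : 0 < Num.min r 1 / 2 by rewrite divr_gt0 // lt_min r0 ltr01.
apply: (@Kitai_IplusT _ _ _ iota _ _ _ _ _ _ _ (Num.min r 1 / 2) _ _ _ c) => //.
  by rewrite ler_piMl // ge_min lexx orbT.
move=> n; apply: le_trans (Hr n); rewrite ler_pM2l // mulrC divfK //.
rewrite lerXn2r ?nnegrE ?(ltW r0)// ?ge_min ?lexx//.
by rewrite le_min ltW //= ler01.
Qed.

(* Scalars K = R (modulus = absolute value) and K = C = R[i] (modulus = normc). *)
Theorem theorem1p2 (R : realType) :
  theorem_for (@Num.norm R R) /\ theorem_for (@Normc.normc R).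
Proof.
split.
  apply: (@theorem_for_abs _ _ _ idfun) => //.
  - by move=> x /normr0_eq0.
  - exact: normrM.
  - exact: ler_normD.
apply: (@theorem_for_abs _ _ _ (real_complex R)).
- by case=> a b; exact: sqrtr_ge0.
- exact: Normc.eq0_normc.
- exact: Normc.normcM.
- exact: le_normcD.
- by move=> r; rewrite /= expr0n addr0 sqrtr_sqr.
Qed.
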